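(* Let $\Gamma$ be a non self-dual Borel class. (1) If $\Gamma\ne\Sigma^0_1$, then there is no Acyclic oriented graph which is $\sqsubseteq_c$-minimum among non-pot$(\Gamma)$ Borel Acyclic oriented graphs (on Polish spaces). (2) If $\Gamma$ is of rank at least two, then there is no relation which is $\sqsubseteq_c$-minimum among non-pot$(\Gamma)$ Borel relations $B$ on Polish spaces $X$ that are contained in a pot$(\Gamma\oplus\check\Gamma)$ Acyclic oriented graph on $X$. (3) If $\Gamma=\Pi^0_1$, then there is no relation which is $\sqsubseteq_c$-minimum among non-pot$(\Gamma)$ Borel locally countable relations $B$ on Polish spaces $X$ that are contained in a pot$(D_2(\Sigma^0_1))$ Acyclic oriented graph on $X$.
   Context: A non self-dual Borel class is $\Sigma^0_\xi$ or $\Pi^0_\xi$ ($1\le\xi<\omega_1$), $\xi$ its rank; $\check\Gamma$ is the class of complements. $\Gamma\oplus\check\Gamma$ is the class of sets of the form $(A\cap C)\cup(B\setminus C)$ with $A\in\Gamma$, $B\in\check\Gamma$, $C$ clopen. $D_2(\Sigma^0_1)$ is the class of differences of two open sets. For a relation $A$ on $X$: $A^{-1}:=\{(x,y)\mid(y,x)\in A\}$, $s(A):=A\cup A^{-1}$; $A$ is acyclic if there is no injective sequence $(x_i)_{i\le n}$, $n\ge2$, with $(x_i,x_{i+1})\in A$ for $i<n$ and $(x_n,x_0)\in A$; $A$ is Acyclic if $s(A)$ is acyclic; an oriented graph is an irreflexive relation with $A\cap A^{-1}\subseteq\Delta(X)$; locally countable means all horizontal and vertical sections are countable. A Borel $B\subseteq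 X\times X$ is pot$(\Gamma)$ if there are finer Polish topologies $\sigma,\tau$ on $X$ with $B\in\Gamma((X,\sigma)\times(X,\tau))$. $(X,A)\sqsubseteq_c(Y,B)$ means there is an injective continuous $f:X\to Y$ with $(f(x),f(y))\in B\iff(x,y)\in A$. An element $b$ of a class $\mathcal{C}$ of such pairs is minimum if $b\sqsubseteq_c a$ for every $a\in\mathcal{C}$. *)

(* Defs.v *)
From HB Require Import structures.
From mathcomp Require Import all_boot all_order all_algebra.
From mathcomp Require Import all_classical all_reals all_analysis.

Set Implicit Arguments.
Unset Strict Implicit.
Unset Printing Implicit Defensive.

Local Open Scope classical_set_scope.

(* Countable ordinals xi with 1 <= xi: [ord_one] denotes 1 and [ord_lsub f] the
   least ordinal strictly above every [f n]. Every xi with 1 < xi < omega_1 is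
   [ord_lsub f] for f an enumeration of (codes of) the ordinals of [1, xi).
   An ordinal has several codes; [ord_le] and [ord_lt] compare the ordinals
   that are denoted, so everything below depends on these only. *)
Inductive ctbl_ord : Type :=
| ord_one : ctbl_ord
| ord_lsub : (nat -> ctbl_ord) -> ctbl_ord.

Fixpoint ord_le (x y : ctbl_ord) : Prop :=
  match x, y with
  | ord_one, _ => True
  | ord_lsub _, ord_one => False
  | ord_lsub f, ord_lsub g => forall n, exists m, ord_le (f n) (g m)
  end.

Definition ord_lt (x y : ctbl_ord) : Prop :=
  match y with
  | ord_one => False
  | ord_lsub g => exists m, ord_le x (g m)
  end.

Inductive Sigma0 (T : topologicalType) : ctbl_ord -> set T -> Prop :=
| Sigma0_open (A : set T) : open A -> Sigma0 ord_one A
| Sigma0_bigcup (xi : ctbl_ord) (eta : nat -> ctbl_ord) (A : nat -> set T) :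
    (forall n, ord_lt (eta n) xi) ->
    (forall n, Sigma0 (eta n) (~` A n)) ->
    Sigma0 xi (\bigcup_n A n).

Definition Pi0 (T : topologicalType) (xi : ctbl_ord) (A : set T) : Prop :=
  Sigma0 xi (~` A).

Definition set_class := forall T : topologicalType, set (set T).

Inductive borel_class : Type :=
| SigmaClass : ctbl_ord -> borel_class
| PiClass : ctbl_ord -> borel_class.

Definition class_rank (G : borel_class) : ctbl_ord :=
  match G with SigmaClass xi => xi | PiClass xi => xi end.

Definition class_sets (G : borel_class) : set_class := fun T =>
  match G with
  | SigmaClass xi => [set A | Sigma0 xi A]
  | PiClass xi => [set A | Pi0 xi A]
  end.

Definition dual_class (G : set_class) : set_class := fun T =>
  [set A | G T (~` A)].

Definition oplus_class (G H : set_class) : set_class := fun T =>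
  [set S | exists A B C : set T,
    [/\ G T A, H T B, clopen C & S = (A `&` C) `|` (B `\` C)]].

Definition D2_open : set_class := fun T =>
  [set S | exists A B : set T, [/\ open A, open B & S = A `\` B]].

Definition separable (T : topologicalType) : Prop :=
  exists2 D : set T, countable D & dense D.

(* The metric structure carries its own topology, required to be that of T. *)
Definition completely_metrizable (R : realType) (T : topologicalType) : Prop :=
  exists m : Metric R T, let M : metricType R := Metric.Pack m in
    (forall A : set T, @open T A <-> @open M A) /\
    (forall F : set_system M, ProperFilter F -> cauchy F ->
       exists x : M, F --> x).

Definition polish (R : realType) (T : topologicalType) : Prop :=
  separable T /\ completely_metrizable R T.

Definition borel (T : topologicalType) : set (set T) := <<s @open T >>.

Definition finer_polish (R : realType) (X : topologicalType)
    (s : Topological X) : Prop :=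
  polish R (Topological.Pack s) /\
  (forall A : set X, @open X A -> @open (Topological.Pack s) A).

Definition pot (R : realType) (G : set_class) (X : topologicalType)
    (B : set (X * X)) : Prop :=
  borel B /\
  exists s t : Topological X,
    [/\ finer_polish R s, finer_polish R t &
        G (Topological.Pack s * Topological.Pack t)%type B].

Definition rel_inv (X : Type) (A : set (X * X)) : set (X * X) :=
  [set p | A (p.2, p.1)].

Definition sym_closure (X : Type) (A : set (X * X)) : set (X * X) :=
  A `|` rel_inv A.

Definition acyclic (X : Type) (A : set (X * X)) : Prop :=
  ~ exists (n : nat) (x : nat -> X),
      [/\ (2 <= n)%N,
          forall i j, (i <= n)%N -> (j <= n)%N -> x i = x j -> i = j,
          forall i, (i < n)%N -> A (x i, x i.+1) &
          A (x n, x 0%N)].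

Definition oriented_graph (X : Type) (A : set (X * X)) : Prop :=
  (forall x, ~ A (x, x)) /\
  A `&` rel_inv A `<=` [set p | p.1 = p.2].

(* This is "Acyclic oriented graph" with a capital A: s(A) is acyclic. *)
Definition Acyclic_oriented_graph (X : Type) (A : set (X * X)) : Prop :=
  acyclic (sym_closure A) /\ oriented_graph A.

Definition locally_countable (X : Type) (A : set (X * X)) : Prop :=
  (forall x, countable (xsection A x)) /\ (forall y, countable (ysection A y)).

Definition reduces (X Y : topologicalType) (A : set (X * X))
    (B : set (Y * Y)) : Prop :=
  exists f : X -> Y, [/\ injective f, continuous f &
    forall x y, B (f x, f y) <-> A (x, y)].

Definition rel_class := forall X : topologicalType, set (X * X) -> Prop.

Definition minimum (C : rel_class) (X : topologicalType)
    (A : set (X * X)) : Prop :=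
  C X A /\
  forall (Y : topologicalType) (B : set (Y * Y)), C Y B -> reduces A B.

Definition has_minimum (C : rel_class) : Prop :=
  exists (X : topologicalType) (A : set (X * X)), minimum C A.

Definition nonpot_Acyclic_graphs (R : realType) (G : set_class) : rel_class :=
  fun X A => [/\ polish R X, borel A, Acyclic_oriented_graph A & ~ pot R G A].

Definition nonpot_subgraphs (R : realType) (G H : set_class) : rel_class :=
  fun X B => [/\ polish R X, borel B, ~ pot R G B &
    exists A : set (X * X), [/\ pot R H A, Acyclic_oriented_graph A & B `<=` A]].

(* Main.v *)
(* Two graphs with no common non-pot(Gamma) reduct.  Attach to every level l a
   pair of words (s, t) of length l and a label, every such datum occurring at
   unboundedly many levels, and let F be the closed set of pairs (x, y) with
   x(0) = 0, y(0) = 1 that differ at a level l > 0 only when (x|l, y|l) = (s, t)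
   and (x(l), y(l)) = (0, 1).  Each level joins two copies of the previous finite
   graph by one edge, so s(F) is acyclic.  The labels of the levels where x and y
   differ decode (x, y) into a point of the Cantor space; let S be the set of
   pairs of F whose decoding lies in a set C outside Gamma.

   S is not pot(Gamma): finer Polish topologies agree with the usual one off a
   meager set, and a fusion yields a continuous section of the decoding with
   values in F that avoids this meager set.  The same holds for the orientation
   S u (F \ S)^-1 of F.  A minimum A would reduce to both.  The first reduction
   separates the sources of A from its sinks by a clopen set; the second then
   exhibits A as the trace on a clopen rectangle of a preimage of s(F), so A is
   closed, hence pot(Gamma).

   When local countability is required, F is cut down to the pairs that differ
   at one level l > 0 at most. *)
Require Import Defs.
From HB Require Import structures.
From mathcomp Require Import all_boot all_order all_algebra.
From mathcomp Require Import all_classical all_reals all_analysis.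
From mathcomp Require Import zify.

Set Implicit Arguments.
Unset Strict Implicit.
Unset Printing Implicit Defensive.

Import Order.TTheory GRing.Theory Num.Theory.
Local Open Scope classical_set_scope.

(** * The Cantor space as a Polish metric space *)

Definition agree (n : nat) (x y : nat -> bool) : Prop :=
  forall k, (k < n)%N -> x k = y k.

Lemma agree_sym n x y : agree n x y -> agree n y x.
Proof. by move=> h k kn; rewrite h. Qed.

Lemma agree_trans n x y z : agree n x y -> agree n y z -> agree n x z.
Proof. by move=> h1 h2 k kn; rewrite h1 // h2. Qed.

Lemma agree_le m n x y : (m <= n)%N -> agree n x y -> agree m x y.
Proof. by move=> mn h k km; apply: h; apply: leq_trans km mn. Qed.

Lemma agree_eq x y : (forall n, agree n x y) -> x = y.
Proof. by move=> h; apply/funext => k; apply: (h k.+1). Qed.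

(** The alias carries [R] so that a metric with values in [R] can be attached to the sequences. *)
Definition cantor (R : realType) : Type := nat -> bool.

HB.instance Definition _ (R : realType) := gen_eqMixin (cantor R).
HB.instance Definition _ (R : realType) := gen_choiceMixin (cantor R).

Section cantor_metric.
Context (R : realType).
Local Open Scope ring_scope.
Implicit Types x y z : nat -> bool.

(** The value [0] for equal sequences is a dummy, as [cdist] tests equality first. *)
Definition first_diff x y : nat :=
  match pselect (exists n, x n != y n) with
  | left h => ex_minn h
  | right _ => 0%N
  end.

Definition cdist x y : R :=
  if `[< x = y >] then 0 else (first_diff x y).+1%:R^-1.

Lemma first_diffP x y : x <> y ->
  agree (first_diff x y) x y /\ x (first_diff x y) != y (first_diff x y).
Proof.
move=> xy; rewrite /first_diff; case: pselect => [h|h]; last first.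
  exfalso; apply: xy; apply/funext => n; apply/eqP/negPn/negP => xyn.
  by apply: h; exists n.
case: ex_minnP => n xyn hn; split => // k kn; apply/eqP/negPn/negP => xyk.
by have := hn _ xyk; rewrite leqNgt kn.
Qed.

(** A first difference at position $d$ gives distance $1/(d+1)$, which is below $1/(n+1)$ exactly
    when $d > n$; hence agreement on $n+1$ bits. *)
Lemma cdist_ltP n x y : cdist x y < n.+1%:R^-1 <-> agree n.+1 x y.
Proof.
rewrite /cdist; case: asboolP => [->|/first_diffP [h1 h2]].
  by split=> // _; rewrite invr_gt0 ltr0n.
rewrite ltf_pV2 ?posrE ?ltr0n// ltr_nat ltnS; split => h.
  exact: agree_le h1.
by rewrite leqNgt; apply/negP => h3; move/negP: h2; apply; apply/eqP/h.
Qed.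

Lemma cdist_ge0 x y : 0 <= cdist x y.
Proof. by rewrite /cdist; case: ifP => // _; rewrite invr_ge0 ler0n. Qed.

Lemma cdistxx x : cdist x x = 0.
Proof. by rewrite /cdist asboolT. Qed.

Lemma cdist_positivity x y : cdist x y = 0 -> x = y.
Proof.
rewrite /cdist; case: asboolP => // _ /eqP.
by rewrite invr_eq0 pnatr_eq0.
Qed.

Lemma cdist_ultra y x z : cdist x z <= Num.max (cdist x y) (cdist y z).
Proof.
rewrite leNgt; apply/negP; rewrite gt_max => /andP[].
rewrite {2 4}/cdist; case: asboolP => [_ h|/first_diffP [h1 h2]].
  by have := cdist_ge0 x y; rewrite leNgt h.
move=> /cdist_ltP a1 /cdist_ltP a2; move/negP: h2; apply; apply/eqP.
by rewrite a1 // a2.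
Qed.

Lemma cdist_triangle y x z : cdist x z <= cdist x y + cdist y z.
Proof.
apply: le_trans (cdist_ultra y x z) _.
by rewrite ge_max lerDl lerDr !cdist_ge0.
Qed.

Lemma cdist_sym x y : cdist x y = cdist y x.
Proof.
have h u v : cdist u v <= cdist v u.
  rewrite leNgt; apply/negP; rewrite {2}/cdist; case: asboolP => [_|uv].
    by rewrite ltNge cdist_ge0.
  have [h1 h2] := first_diffP uv => /cdist_ltP h.
  by move/negP: h2; apply; rewrite h.
by apply/eqP; rewrite eq_le !h.
Qed.

End cantor_metric.

HB.instance Definition _ (R : realType) := @isMetric.Build R (cantor R)
  (@cdist R) (@cdistxx R) (@cdist_positivity R) (@cdist_sym R) (@cdist_triangle R).

Section cantor_topology.
Context (R : realType).
Local Open Scope ring_scope.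
Local Notation E := (cantor R).

Lemma inv_natr_lt (e : R) : 0 < e -> exists n, n.+1%:R^-1 < e.
Proof.
move=> e0; exists (Num.truncn e^-1).
rewrite invf_plt ?posrE ?ltr0n//.
by have := truncnS_gt e^-1.
Qed.

Lemma nbhs_cantor (x : E) (A : set E) :
  nbhs x A <-> exists n, forall y, agree n x y -> A y.
Proof.
rewrite -metricType_numDomainType.filter_from_mdist_nbhs; split.
  move=> [e e0 h]; have [n ne] := inv_natr_lt e0.
  by exists n.+1 => y /(@cdist_ltP R) xy; apply: h; apply: lt_trans xy ne.
move=> [n h]; exists (n.+1%:R^-1); first by rewrite /= invr_gt0 ltr0n.
by move=> y /cdist_ltP xy; apply: h; apply: agree_le xy.
Qed.

Lemma open_cantor (A : set E) :
  open A <-> forall x, A x -> exists n, forall y, agree n x y -> A y.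
Proof.
rewrite openE; split => h x Ax; first exact/nbhs_cantor/h.
exact/nbhs_cantor/h.
Qed.

Lemma separable_cantor : separable E.
Proof.
exists (range (fun s : seq bool => (nth false s : E))).
  by apply: (card_le_trans (card_image_le _ _)); exact: countableP.
move=> O [x Ox] /open_cantor /(_ x Ox) [n h].
exists (nth false (mkseq x n)); split; last by exists (mkseq x n).
by apply: h => k kn; rewrite nth_mkseq.
Qed.

Lemma complete_cantor (F : set_system E) :
  ProperFilter F -> cauchy F -> exists x : E, F --> x.
Proof.
move=> FF Fc.
have h n : exists x : E, F [set y | agree n x y].
  have e0 : (0 : R) < n.+1%:R^-1 by rewrite invr_gt0 ltr0n.
  have /cauchyP /(_ _ e0) [x Fx] := Fc.
  exists x; apply: filterS Fx => y.
  rewrite /= ballEmdist /= => /cdist_ltP; exact: agree_le.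
have [u Hu] := choice h.
(* The filter fixes the first [n] bits of [u n], so bit [k] of the limit is read from [u k.+1], the
   first term in which it is fixed. *)
pose x : E := fun k => u k.+1 k.
exists x => A /nbhs_cantor [n hA].
suff : F [set y | agree n x y] by apply: filterS.
elim: n {hA} => [|n IH]; first by apply: filterS filterT.
apply: filterS (filterI IH (Hu n.+1)) => y [h1 h2] k; rewrite ltnS leq_eqVlt.
by case/orP => [/eqP ->|/h1 //]; apply: h2.
Qed.

Lemma polish_cantor : polish R E.
Proof.
split; first exact: separable_cantor.
exists (Metric.class E) => M; split=> //.
exact: complete_cantor.
Qed.

End cantor_topology.

(** * The acyclic graph *)

(* The 2-adic valuation of l + 1 takes every value at unboundedly many l.  A word
   is read through [nth false], hence padded with [false] if shorter than l. *)
Definition level_code (l : nat) : seq bool * seq bool * nat :=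
  odflt ([::], [::], 0%N) (unpickle (logn 2 l.+1)).

Definition label (l : nat) : nat := (level_code l).2.

Lemma level_code_unbounded s t c n : exists2 l, (n <= l)%N & level_code l = (s, t, c).
Proof.
pose i := pickle (s, t, c).
have l0 : (0 < 2 ^ i * n.*2.+1)%N by rewrite muln_gt0 expn_gt0.
(* The factor $2n+1$ is odd, so it leaves the valuation of $l+1$ equal to [i] while making [l]
   large. *)
exists (2 ^ i * n.*2.+1).-1.
  rewrite -ltnS prednK //; apply: (@leq_trans n.*2.+1); first by rewrite -addnn; lia.
  by rewrite leq_pmull // expn_gt0.
rewrite /level_code prednK // lognM ?expn_gt0 // pfactorK // (@logn_coprime 2) ?addn0.
  by rewrite /i pickleK.
by rewrite coprime2n /= odd_double.
Qed.

Definition special (l : nat) (x y : nat -> bool) : Prop :=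
  [/\ agree l x (nth false (level_code l).1.1), agree l y (nth false (level_code l).1.2),
      x l = false & y l = true].

Definition step (l : nat) (x y : nat -> bool) : Prop :=
  x l = y l \/ special l x y.

(** What membership in [sym_closure tree_graph] imposes on the bits below [n], with one orientation
    for all levels; it allows induction on [n]. *)
Definition adj (n : nat) (x y : nat -> bool) : Prop :=
  (forall l, (l < n)%N -> step l x y) \/ (forall l, (l < n)%N -> step l y x).

Lemma bit_constant (b : nat -> bool) p q : (p <= q)%N ->
  (forall i, (p <= i < q)%N -> b i = b i.+1) -> b p = b q.
Proof.
move=> pq; rewrite -(subnKC pq); elim: (q - p)%N => [|k IH] h; first by rewrite addn0.
rewrite IH; first by rewrite addnS; apply: h; lia.
by move=> i hi; apply: h; lia.
Qed.

(** Around a cycle, a bit that changes must change at least twice. If only the edge between [p] and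
    [q] may change it, the other arc from [p] to [q] forces equal values. *)
Lemma single_flip_cycle (b : nat -> bool) n p q :
  (2 <= n)%N -> (p < q <= n)%N -> b p <> b q ->
  (forall i, (i < n)%N -> b i <> b i.+1 -> p = i /\ q = i.+1) ->
  (b n <> b 0%N -> p = 0%N /\ q = n) -> False.
Proof.
move=> n2 /andP[pq qn] bpq h h0; case: (eqVneq q p.+1) => [qp|qp]; last first.
  apply: bpq; apply: bit_constant; first exact: ltnW.
  move=> i hi; apply: contrapT => bi.
  have /(h i) /(_ bi) [] : (i < n)%N by lia.
  by move: qp => /eqP; lia.
apply: bpq.
(* Here the edge is [p], [p.+1] and the other arc passes through the closing edge from [n] to [0];
   since [2 <= n] the two edges differ. *)
have b0n : b n = b 0%N by apply: contrapT => /h0 []; lia.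
have -> : b p = b 0%N.
  symmetry; apply: bit_constant => // i hi; apply: contrapT => bi.
  have /(h i) /(_ bi) [] : (i < n)%N by lia.
  by lia.
rewrite -b0n; symmetry; apply: bit_constant => // i hi; apply: contrapT => bi.
have /(h i) /(_ bi) [] : (i < n)%N by lia.
by lia.
Qed.

Lemma adj_bit l x y : adj l.+1 x y ->
  adj l x y /\ (x l <> y l -> special l x y \/ special l y x).
Proof.
case=> h; split.
- by left=> k kl; apply: h; apply: ltnW.
- by case: (h l (ltnSn l)) => // s _; left.
- by right=> k kl; apply: h; apply: ltnW.
- by case: (h l (ltnSn l)) => [->//|s _]; right.
Qed.

Lemma special_agree_l l x y x' y' :
  special l x y -> special l x' y' -> agree l.+1 x x'.
Proof.
move=> [h1 _ h2 _] [h1' _ h2' _] k; rewrite ltnS leq_eqVlt => /orP[/eqP ->|kl].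
  by rewrite h2 h2'.
by rewrite h1 // h1'.
Qed.

Lemma special_agree_r l x y x' y' :
  special l x y -> special l x' y' -> agree l.+1 y y'.
Proof.
move=> [_ h1 _ h2] [_ h1' _ h2'] k; rewrite ltnS leq_eqVlt => /orP[/eqP ->|kl].
  by rewrite h2 h2'.
by rewrite h1 // h1'.
Qed.

(* Level l+1 is two copies of level l joined by the single edge [special l],
   so a cycle either projects to level l or crosses that edge exactly once. *)
Lemma no_finite_cycle l n (x : nat -> nat -> bool) : (2 <= n)%N ->
  (forall i j, (i <= n)%N -> (j <= n)%N -> agree l (x i) (x j) -> i = j) ->
  (forall i, (i < n)%N -> adj l (x i) (x i.+1)) -> adj l (x n) (x 0%N) -> False.
Proof.
elim: l => [|l IH] n2 inj hx hx0.
  (* At level 0 any two sequences agree, so the separation hypothesis identifies two indices. *)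
  by have : 0%N = 1%N by apply: inj => //; exact: ltnW.
pose b i := x i l.
case: (pselect (exists p, exists q, [/\ (p <= n)%N, (q <= n)%N
    & special l (x p) (x q)])) => [[p [q [pn qn spq]]]|nsp]; last first.
  have flip i j : (i <= n)%N -> (j <= n)%N -> adj l.+1 (x i) (x j) -> b i = b j.
    move=> ni nj /adj_bit [_ h]; apply: contrapT => /h [] s; apply: nsp.
      by exists i, j.
    by exists j, i.
  have b0 i : (i <= n)%N -> b i = b 0%N.
    move=> ni; symmetry; apply: bit_constant => // j hj.
    have jn : (j < n)%N by lia.
    exact: (flip _ _ (ltnW jn) jn (hx _ jn)).
  apply: IH => //.
  - move=> i j ni nj h; apply: inj => // k; rewrite ltnS leq_eqVlt.
    by move=> /orP[/eqP ->|/h //]; move: (b0 i ni) (b0 j nj); rewrite /b => -> ->.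
  - by move=> i /hx /adj_bit [].
  - by case/adj_bit: hx0.
have pq : p <> q.
  by move=> e; move: spq; rewrite e => -[_ _ ->].
(* The special edge of level [l] has determined endpoints up to [l.+1] bits, so by separation only
   [x p] and [x q] can realise it. *)
have flip i j : (i <= n)%N -> (j <= n)%N -> adj l.+1 (x i) (x j) -> b i <> b j ->
    (p = i /\ q = j) \/ (p = j /\ q = i).
  move=> ni nj /adj_bit [_ h] /h [] s; [left|right]; split; apply: inj => //.
  - exact: special_agree_l spq s.
  - exact: special_agree_r spq s.
  - exact: special_agree_l spq s.
  - exact: special_agree_r spq s.
have bpq : b p <> b q by case: spq => _ _; rewrite /b => -> ->.
have [ltpq|ltqp|//] := ltngtP p q.
- apply: (@single_flip_cycle b n p q) => //; first by lia.
    by move=> i ni bi; case: (flip i i.+1 _ _ (hx i ni) bi); lia.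
  by move=> bn; case: (flip n 0%N _ _ hx0 bn); lia.
- apply: (@single_flip_cycle b n q p) => //; first by lia.
  + by move=> e; apply: bpq.
  + by move=> i ni bi; case: (flip i i.+1 _ _ (hx i ni) bi); lia.
  + by move=> bn; case: (flip n 0%N _ _ hx0 bn); lia.
Qed.

Definition tree_graph : set ((nat -> bool) * (nat -> bool)) :=
  [set p | [/\ p.1 0%N = false, p.2 0%N = true & forall l, step l p.1 p.2]].

(** Each of the finitely many pairs of distinct points is separated at some length; the maximum
    serves for all. *)
Lemma agree_separates n (x : nat -> nat -> bool) :
  (forall i j, (i <= n)%N -> (j <= n)%N -> x i = x j -> i = j) ->
  exists l, forall i j, (i <= n)%N -> (j <= n)%N -> agree l (x i) (x j) -> i = j.
Proof.
move=> inj.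
have h (ij : 'I_n.+1 * 'I_n.+1) : exists l : nat,
    agree l (x ij.1) (x ij.2) -> ij.1 = ij.2.
  case: (pselect (ij.1 = ij.2)) => [|ne]; first by exists 0%N.
  have : ~ forall l, agree l (x ij.1) (x ij.2).
    move=> /agree_eq e; apply/ne/val_inj/inj => //; rewrite -ltnS; exact: ltn_ord.
  by move=> /existsNP[l nl]; exists l.
have [f hf] := choice h.
exists (\max_ij f ij) => i j ni nj a.
have := hf (inord i, inord j); rewrite /= !inordK // => /(_ _) e.
suff /e /(congr1 val) : agree (f (inord i, inord j)) (x i) (x j).
  by rewrite /= !inordK.
by apply: agree_le a; apply: leq_bigmax.
Qed.

Lemma acyclic_tree_graph : acyclic (sym_closure tree_graph).
Proof.
move=> [n [x [n2 inj hx hx0]]].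
have [l hl] := agree_separates inj.
have adjP u v : sym_closure tree_graph (u, v) -> adj l u v.
  by case=> -[_ _ h]; [left|right] => k _; apply: h.
apply: (@no_finite_cycle l n x n2 hl).
  by move=> i ni; apply/adjP/hx.
exact: adjP.
Qed.

Lemma acyclic_subset (X : Type) (A B : set (X * X)) :
  A `<=` B -> acyclic B -> acyclic A.
Proof.
move=> AB nB [n [x [n2 inj hx hx0]]]; apply: nB; exists n, x; split=> //.
- by move=> i ni; apply/AB/hx.
- exact: AB.
Qed.

(** * The Borel hierarchy and complete sets *)

Lemma ord_le_refl x : ord_le x x.
Proof. by elim: x => //= f IH n; exists n. Qed.

Lemma ord_le_trans y x z : ord_le x y -> ord_le y z -> ord_le x z.
Proof.
elim: x y z => [|f IH] [|g] [|h] //= fg gh n.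
have [m fm] := fg n; have [p gp] := gh m; exists p; exact: IH gp.
Qed.

(** Perfect in the sense that open sets are $F_\sigma$, not in the sense of having no isolated
    point. This makes the classes increase with the rank. *)
Definition perfect (T : topologicalType) : Prop := forall O : set T, open O ->
  exists C : nat -> set T, (forall n, closed (C n)) /\ O = \bigcup_n C n.

Lemma perfect_pseudometric (R : realType) (T : pseudoMetricType R) : perfect T.
Proof.
move=> O oO.
(* Balls of a pseudometric structure need not be open, whence the interior in the closed pieces
   below. *)
pose V n := \bigcup_(y in ~` O) ball y (n.+1%:R^-1 : R)%R.
exists (fun n => ~` (V n)°); split=> [n|].
  by apply: open_closedC; exact: open_interior.
apply/seteqP; split => x.
  move=> Ox; have /nbhs_ballP [e e0 he] : nbhs x O by exact: open_nbhs_nbhs.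
  have [n ne] := inv_natr_lt e0; exists n => // /interior_subset [y nOy xy].
  by apply/nOy/he; apply: le_ball (ltW ne) _ (ball_sym xy).
move=> [n _ nV]; apply: contrapT => nOx; apply: nV.
have e0 : (0 < n.+1%:R^-1 :> R)%R by rewrite invr_gt0 ltr0n.
apply: filterS (nbhsx_ballx x _ e0) => y xy; by exists x.
Qed.

Section Sigma0_theory.
Context (T : topologicalType).
Implicit Types (A B : set T) (xi eta : ctbl_ord).

(** Inversion: nothing lies strictly below [ord_one], so the union constructor cannot produce a set
    of rank one. *)
Lemma Sigma0_inv xi A : Sigma0 xi A ->
  match xi with
  | ord_one => open A
  | ord_lsub g => exists (m : nat -> nat) (eta : nat -> ctbl_ord) (B : nat -> set T),
     [/\ forall n, ord_le (eta n) (g (m n)), forall n, Sigma0 (eta n) (~` B n)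
       & A = \bigcup_n B n]
  end.
Proof.
move=> h; case: h => {xi A} [A //|xi eta A h hA].
case: xi h => [h|g h]; first by exfalso; exact: (h 0%N).
have [m hm] := choice h.
by exists m, eta, A.
Qed.

Lemma Sigma0_setT xi : Sigma0 xi [set: T].
Proof.
elim: xi => [|g IH]; first by apply: Sigma0_open; exact: openT.
rewrite (_ : setT = \bigcup_(n in [set: nat]) setT); last first.
  by rewrite bigcup_const //; exists 0%N.
apply: (@Sigma0_bigcup _ _ (fun=> ord_one)) => [_|_ /=].
  by exists 0%N.
by rewrite setCT; apply: Sigma0_open; exact: open0.
Qed.

Lemma Sigma0_closed xi A : ord_lt ord_one xi -> closed A -> Sigma0 xi A.
Proof.
move=> xi1 cA; rewrite (_ : A = \bigcup_(n in [set: nat]) A); last first.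
  by rewrite bigcup_const //; exists 0%N.
by apply: (@Sigma0_bigcup _ _ (fun=> ord_one)) => // _; apply/Sigma0_open/closed_openC.
Qed.

Lemma Sigma0_borel xi A : Sigma0 xi A -> borel A.
Proof.
elim=> {xi A} [A oA|xi eta A _ _ IH].
  exact: sub_gen_smallest.
have [h0 hC hU] := smallest_sigma_algebra [set: T] (@open T).
by apply: hU => n; have := hC _ (IH n); rewrite setTD setCK.
Qed.

Hypothesis pT : perfect T.

Lemma Sigma0_open_le xi A : open A -> Sigma0 xi A.
Proof.
case: xi => [|g] oA; first exact: Sigma0_open.
have [C [cC ->]] := pT oA.
apply: (@Sigma0_bigcup _ _ (fun=> ord_one)) => n; first by exists 0%N.
by apply/Sigma0_open/closed_openC.
Qed.

Lemma Sigma0_le eta xi A : ord_le eta xi -> Sigma0 eta A -> Sigma0 xi A.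
Proof.
case: eta => [_ /Sigma0_inv /Sigma0_open_le //|f].
case: xi => // g fg /Sigma0_inv [m [eta [B [h hB ->]]]].
apply: (Sigma0_bigcup _ hB) => n; have [p hp] := fg (m n); exists p.
exact: ord_le_trans hp.
Qed.

Lemma Sigma0_setU xi A B : Sigma0 xi A -> Sigma0 xi B -> Sigma0 xi (A `|` B).
Proof.
case: xi => [|g] /Sigma0_inv hA /Sigma0_inv hB.
  by apply/Sigma0_open/openU.
move: hA hB => [m [eta [C [h hC ->]]]] [m' [eta' [C' [h' hC' ->]]]].
pose D n := if odd n then C n./2 else C' n./2.
rewrite (_ : _ `|` _ = \bigcup_n D n); last first.
  apply/seteqP; split => x.
    case=> -[n _ Cx]; [exists n.*2.+1|exists n.*2] => //; rewrite /D /= odd_double /=.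
      by rewrite uphalf_double.
    by rewrite doubleK.
  by move=> [n _]; rewrite /D; case: ifP => _ ?; [left|right]; exists n./2.
apply: (@Sigma0_bigcup _ _ (fun n => if odd n then eta n./2 else eta' n./2)) => n.
  by case: ifP => _; [exists (m n./2)|exists (m' n./2)].
by rewrite /D; case: ifP.
Qed.

(** Cutting each piece of the union by [F] only adds an open set to its complement, which stays in
    its class. *)
Lemma Sigma0_setI_closed xi A F : ord_lt ord_one xi -> closed F ->
  Sigma0 xi A -> Sigma0 xi (A `&` F).
Proof.
case: xi => // g _ cF /Sigma0_inv [m [eta [B [h hB ->]]]].
rewrite setI_bigcupl; apply: (@Sigma0_bigcup _ _ eta) => n; first by exists (m n).
rewrite setCI; apply: Sigma0_setU => //.
by apply: Sigma0_open_le; exact: closed_openC.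
Qed.

End Sigma0_theory.

Lemma Sigma0_preimage (S T : topologicalType) (f : S -> T) xi (A : set T) :
  continuous f -> Sigma0 xi A -> Sigma0 xi (f @^-1` A).
Proof.
move=> cf; elim=> {xi A} [A oA|xi eta A h _ IH].
  by apply: Sigma0_open; apply: open_comp.
by rewrite preimage_bigcup; apply: Sigma0_bigcup h _ => n; rewrite preimage_setC; exact: IH.
Qed.

Lemma class_sets_preimage (S T : topologicalType) (f : S -> T) G (A : set T) :
  continuous f -> class_sets G A -> class_sets G (f @^-1` A).
Proof.
by case: G => xi cf /=; [|rewrite /Pi0 preimage_setC]; apply: Sigma0_preimage.
Qed.

Lemma class_sets_closed (T : topologicalType) G (A : set T) : perfect T ->
  G <> SigmaClass ord_one -> closed A -> class_sets G A.
Proof.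
move=> pT; case: G => [[|g]|xi] //= _ cA.
  by apply: Sigma0_closed => //; exists 0%N.
by apply: Sigma0_open_le => //; exact: closed_openC.
Qed.

(** * A complete set for each rank, by diagonalisation *)

Definition pairing (n k : nat) : nat := (2 ^ n * k.*2.+1).-1.
Definition pairing1 (i : nat) : nat := logn 2 i.+1.
Definition pairing2 (i : nat) : nat := (i.+1 %/ 2 ^ logn 2 i.+1)./2.

Lemma pairingS n k : (pairing n k).+1 = (2 ^ n * k.*2.+1)%N.
Proof. by rewrite /pairing prednK // muln_gt0 expn_gt0. Qed.

Lemma pairingK1 n k : pairing1 (pairing n k) = n.
Proof.
rewrite /pairing1 pairingS lognM ?expn_gt0 // pfactorK // (@logn_coprime 2) ?addn0 //.
by rewrite coprime2n /= odd_double.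
Qed.

Lemma pairingK2 n k : pairing2 (pairing n k) = k.
Proof.
have := pairingK1 n k; rewrite /pairing1 /pairing2 => ->.
by rewrite pairingS mulKn ?expn_gt0 //= uphalf_double.
Qed.

(** This keeps the delay when reductions are combined row by row: bit [i] of the result is bit
    [pairing2 i] of a row. *)
Lemma pairing2_le i : (pairing2 i <= i)%N.
Proof.
rewrite /pairing2; set q := (_ %/ _)%N.
have : (q <= i.+1)%N by apply: leq_div.
by move: q => q; lia.
Qed.

Definition row (n : nat) (a : nat -> bool) : nat -> bool :=
  fun k => a (pairing n k).

(** A $\Sigma^0_\xi$-complete set: a union of complements of complete sets of lower ranks, each read
    on its own row. The index [n] repeats every rank infinitely often, so that a union may reuse
    it. *)
Fixpoint hard (xi : ctbl_ord) (a : nat -> bool) : Prop :=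
  match xi with
  | ord_one => exists k, a k
  | ord_lsub g => exists n m : nat, ~ hard (g m) (row (pickle (n, m)) a)
  end.

(** The delay is strict: output bit [n] is decided before input bit [n] is read. This is what gives
    a fixed point. *)
Definition contracting (r : (nat -> bool) -> (nat -> bool)) : Prop :=
  forall x y n, agree n x y -> r x n = r y n.

Lemma contracting_fixpoint r : contracting r -> exists x, r x = x.
Proof.
move=> cr; pose u n := iter n r (fun=> false).
have hu n m : (n <= m)%N -> agree n (u n) (u m).
  elim: n m => [//|n IH] [//|m] nm k; rewrite ltnS => kn; apply: cr.
  by apply: agree_le kn _; exact: IH.
exists (fun k => u k.+1 k); apply/funext => n; rewrite {2}/u iterS; apply: cr.
by move=> k kn; exact: hu.
Qed.

(* The (n, m)-th row of the reduction handles the n-th set of the union when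
   its complement is taken in Sigma0 (g m), and is made to be hard otherwise. *)
Lemma hard_complete (R : realType) xi (A : set (cantor R)) : Sigma0 xi A ->
  exists r, contracting r /\ forall x, A x <-> hard xi (r x).
Proof.
have pE : perfect (cantor R) by exact: perfect_pseudometric.
elim: xi A => [|g IH] A /Sigma0_inv.
  move=> /open_cantor oA.
  (* Bit [n] records whether the cylinder of length [n] around [x] is already inside the open
     set. *)
  exists (fun x n => `[< forall y, agree n x y -> A y >]); split=> [x y n xy|x].
    apply/asbool_equiv_eq; split=> h z yz; apply: h.
      exact: agree_trans yz.
    by apply: agree_trans yz; exact: agree_sym.
  split=> [/oA [n hn]|[n /asboolP]]; last by apply.
  by exists n; apply/asboolP.
move=> [m [eta [B [h hB ->]]]].
have hr (nm : nat * nat) : exists r, contracting r /\ forall x : cantor R,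
    hard (g nm.2) (r x) <-> (nm.2 = m nm.1 -> ~ B nm.1 x).
  case: nm => n p /=; case: (pselect (p = m n)) => [->|ne].
    have /IH [r [cr hr]] := Sigma0_le pE (h n) (hB n).
    by exists r; split=> // x; rewrite -hr; split => // /(_ erefl).
  have /IH [r [cr hr]] := @Sigma0_setT (cantor R) (g p).
  by exists r; split=> // x; rewrite -hr; split.
have [rr hrr] := choice hr.
pose r x i := rr (odflt (0, 0)%N (unpickle (pairing1 i))) x (pairing2 i).
have rrow x nm : row (pickle nm) (r x) = rr nm x.
  by apply/funext => k; rewrite /row /r pairingK1 pairingK2 pickleK.
exists r; split=> [x y n xy|x].
  by apply: (hrr _).1; apply: agree_le xy; exact: pairing2_le.
split=> [[n _ Bx]|[n [p]]].
  by exists n, (m n); rewrite rrow => /(hrr _).2 /(_ erefl).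
rewrite rrow => nh; exists n => //; apply: contrapT => nB; apply: nh.
by apply: ((hrr (n, p)).2 x).2 => _.
Qed.

(** Otherwise the complement has a contracting reduction to [hard xi], whose fixed point lies in the
    set if and only if it does not. *)
Lemma hard_not_Pi0 (R : realType) xi : ~ Pi0 xi ([set x | hard xi x] : set (cantor R)).
Proof.
move=> /hard_complete [r [/contracting_fixpoint [x rx] h]].
have := h x; rewrite rx /= => e; have nx : ~ hard xi x by move=> hx; apply: (e.2 hx).
exact/nx/e.1.
Qed.

(** The map given by the [D k] may be merely semicontinuous. This suffices because rank one asks for
    a true bit, and higher ranks are built from such conditions. *)
Lemma Sigma0_hard (T : topologicalType) xi (D : nat -> set T) : perfect T ->
  (forall k, open (D k)) -> Sigma0 xi [set t | hard xi (fun k => `[< D k t >])].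
Proof.
move=> pT; elim: xi D => [|g IH] D oD.
  apply: Sigma0_open; rewrite (_ : [set _ | _] = \bigcup_k D k); first exact: bigcup_open.
  apply/seteqP; split => t /=; first by move=> [k /asboolP]; exists k.
  by move=> [k _ ?]; exists k; apply/asboolP.
pose nm i : nat * nat := odflt (0, 0)%N (unpickle i).
pose B i := ~` [set t | hard (g (nm i).2)
  (fun k => `[< D (pairing (pickle (nm i)) k) t >])].
rewrite (_ : [set _ | _] = \bigcup_i B i); last first.
  apply/seteqP; split => t /=.
    by move=> [n [m h]]; exists (pickle (n, m)) => //; rewrite /B /nm pickleK.
  by move=> [i _]; rewrite /B; case: (nm i) => n m h; exists n, m.
apply: (@Sigma0_bigcup _ _ (fun i => g (nm i).2)) => i.
  by exists (nm i).2; exact: ord_le_refl.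
by rewrite setCK; apply: IH.
Qed.

(** * Finer Polish topologies agree off a meager set *)

Definition nwdense (N : set (nat -> bool)) : Prop := forall x n,
  exists y m, [/\ agree n x y, (n <= m)%N & forall z, agree m y z -> ~ N z].

Definition meager (A : set (nat -> bool)) : Prop :=
  exists N : nat -> set (nat -> bool),
    (forall k, nwdense (N k)) /\ A `<=` \bigcup_k N k.

Lemma nwdense0 : nwdense set0.
Proof. by move=> x n; exists x, n; split=> // z _ []. Qed.

Lemma meager_subset A B : A `<=` B -> meager B -> meager A.
Proof. by move=> AB [N [hN BN]]; exists N; split=> //; exact: subset_trans BN. Qed.

Lemma meager_nwdense A : nwdense A -> meager A.
Proof. by move=> hA; exists (fun=> A); split=> // x Ax; exists 0%N. Qed.

Lemma meager_union (I : countType) (A : I -> set (nat -> bool)) :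
  (forall i, meager (A i)) -> meager (\bigcup_i A i).
Proof.
move=> /choice[N hN].
exists (fun j => if unpickle (pairing1 j) is Some i then N i (pairing2 j) else set0).
split=> [j|x [i _ /((hN i).2) [k _ Nx]]].
  by case: unpickle => [i|]; [exact: (hN i).1|exact: nwdense0].
by exists (pairing (pickle i) k) => //; rewrite pairingK1 pairingK2 pickleK.
Qed.

Lemma meagerU A B : meager A -> meager B -> meager (A `|` B).
Proof.
move=> mA mB; apply: (@meager_subset _ (\bigcup_(b : bool) if b then A else B)).
  by move=> x [Ax|Bx]; [exists true|exists false].
by apply: meager_union; case.
Qed.

Definition cyl (x : nat -> bool) (n : nat) : set (nat -> bool) :=
  [set y | agree n x y].

Lemma cyl_eq x y n : agree n x y -> cyl x n = cyl y n.
Proof.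
move=> xy; apply/seteqP; split=> z /= h; last exact: agree_trans h.
by apply: agree_trans h; exact: agree_sym.
Qed.

(* Kuratowski's localisation: a closed set that contains A up to a meager set. *)
Definition heavy (A : set (nat -> bool)) : set (nat -> bool) :=
  [set x | forall n, ~ meager (A `&` cyl x n)].

Lemma not_heavy A x : ~ heavy A x -> exists n, meager (A `&` cyl x n).
Proof. by move=> /existsNP[n /contrapT h]; exists n. Qed.

(** A point of [A] that is not heavy has a cylinder in which [A] is meager, and there are only
    countably many cylinders. *)
Lemma meager_not_heavy A : meager (A `\` heavy A).
Proof.
pose C (wn : seq bool * nat) := A `&` cyl (nth false wn.1) wn.2.
pose C' wn := if `[< meager (C wn) >] then C wn else set0.
apply: (@meager_subset _ (\bigcup_wn C' wn)).
  move=> x [Ax /not_heavy [n hn]].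
  have e : cyl (nth false (mkseq x n)) n = cyl x n.
    by apply: cyl_eq => k kn; rewrite nth_mkseq.
  by exists (mkseq x n, n) => //; rewrite /C' /C /= e asboolT.
apply: meager_union => wn; rewrite /C'; case: asboolP => // _.
exact: meager_nwdense nwdense0.
Qed.

(** If some [heavy (B i)] contains a cylinder inside the given one, shrink to it. Otherwise each of
    them is nowhere dense there, so [A] is meager in the given cylinder, which then has no heavy
    point of [A]. *)
Lemma nwdense_heavy_bigcup A (B : nat -> set (nat -> bool)) : A `<=` \bigcup_i B i ->
  nwdense (heavy A `\` \bigcup_i heavy (B i)).
Proof.
move=> AB x n.
case: (pselect (exists i y m, [/\ agree n x y, (n <= m)%N & cyl y m `<=` heavy (B i)])).
  move=> [i [y [m [xy nm h]]]]; exists y, m; split=> // z yz [_ nB].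
  by apply: nB; exists i => //; exact: h.
move=> hB; exists x, n; split=> // z xz [hA _]; apply: (hA n).
rewrite -(cyl_eq xz).
apply: (@meager_subset _ (\bigcup_i ((B i `\` heavy (B i)) `|` (heavy (B i) `&` cyl x n)))).
  move=> y [/AB [i _ By] xy]; exists i => //.
  by case: (pselect (heavy (B i) y)) => h; [right|left].
apply: meager_union => i; apply: meagerU; first exact: meager_not_heavy.
apply: meager_nwdense => y m.
(* If the cylinders of [x] and [y] are disjoint, staying near [y] avoids the set; otherwise they
   have the common point [y'] below. *)
case: (pselect (agree (minn n m) x y)) => [xy|nxy]; last first.
  exists y, (maxn n m); split=> //; first exact: leq_maxr.
  move=> u yu [_ xu]; apply: nxy => k km.
  by rewrite yu ?xu //; lia.
pose y' k := if (k < m)%N then y k else x k.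
have yy' : agree m y y' by move=> k km; rewrite /y' km.
have xy' : agree n x y'.
  move=> k kn; rewrite /y'; case: ifP => // km; apply: xy; lia.
have nsub : ~ cyl y' (maxn n m) `<=` heavy (B i).
  by move=> h; apply: hB; exists i, y', (maxn n m); split => //; exact: leq_maxl.
have [u] : exists u, agree (maxn n m) y' u /\ ~ heavy (B i) u.
  by move: nsub => /existsNP[u /not_implyP h]; exists u.
move=> [y'u /not_heavy [p hp]].
exists u, (maxn m p); split; last 1 first.
- move=> z0 uz0 [h _]; apply: (h p); rewrite -(@cyl_eq u) //.
  by apply: agree_le uz0; exact: leq_maxr.
- by apply: agree_trans yy' _; apply: agree_le y'u; exact: leq_maxr.
- exact: leq_maxl.
Qed.

Lemma not_meager_nonempty A : ~ meager A -> exists x, A x.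
Proof.
move=> h; apply: contrapT => nA; apply: h; apply: (@meager_subset _ set0).
  by move=> x Ax; apply: nA; exists x.
exact: meager_nwdense nwdense0.
Qed.

(* The Souslin scheme of balls along [d] gives the Baire property of the
   analytic set [f @` P]: off a meager set, a heavy point stays heavy along a
   branch of the scheme, and the branch converges to a preimage. *)
Lemma heavy_image (R : realType) (M : metricType R) (d : nat -> M)
    (f : M -> cantor R) (P : set M) :
  (forall (z : M) (e : R), (0 < e)%R -> exists a, ball (d a) e z) ->
  (forall F : set_system M, ProperFilter F -> cauchy F -> exists z : M, F --> z) ->
  continuous f -> closed P ->
  exists2 N, meager N & heavy (f @` P) `\` N `<=` f @` P.
Proof.
move=> dense_d complM cf cP.
pose Q (w : seq nat) : set M := P `&`
  [set z | forall k, (k < size w)%N -> ball (d (nth 0%N w k)) (k.+1%:R^-1 : R)%R z].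
pose A w : set (nat -> bool) := f @` Q w.
pose N := \bigcup_w (heavy (A w) `\` \bigcup_j heavy (A (rcons w j))).
exists N.
  apply: meager_union => w; apply: meager_nwdense; apply: nwdense_heavy_bigcup.
  move=> _ [z [Pz hz] <-].
  have e0 : (0 < (size w).+1%:R^-1 :> R)%R by rewrite invr_gt0 ltr0n.
  have [j hj] := dense_d z _ e0.
  exists j => //; exists z => //; split=> // k; rewrite size_rcons ltnS leq_eqVlt nth_rcons.
  by move=> /orP[/eqP ->|kw]; [rewrite ltnn eqxx|rewrite kw; exact: hz].
have A0 : f @` P = A [::].
  by apply/seteqP; split=> [_ [z Pz <-]|_ [z [Pz _] <-]]; exists z.
rewrite A0 => x [x0 nNx]; rewrite -A0.
have nextP w : exists j, heavy (A w) x -> heavy (A (rcons w j)) x.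
  case: (pselect (heavy (A w) x)) => hw; last by exists 0%N.
  apply: contrapT => /forallNP nj; apply: nNx; exists w => //; split=> // -[j _ hj].
  by apply: (nj j).
have [g hg] := choice nextP.
pose W n := iter n (fun w => rcons w (g w)) [::].
have hW n : heavy (A (W n)) x by elim: n => //= n; exact: hg.
have WE n : W n = mkseq (fun k => g (W k)) n.
  by elim: n => // n IH; rewrite mkseqS -IH.
(* Heaviness at [x] gives a point satisfying the first [n] ball constraints whose image agrees with
   [x] on [n] bits. *)
have zP n : exists z, Q (W n) z /\ agree n x (f z).
  by have [_ [[z Qz <-] xz]] := not_meager_nonempty (hW n n); exists z.
have [z hz] := choice zP.
have [l zl] : exists l : M, z @ \oo --> l.
  apply: complM; apply/cauchyP => e /inv_natr_lt [k ke].
  exists (d (g (W k))); exists k.+1 => // n /= kn.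
  have := (hz n).1.2 k; rewrite WE size_mkseq nth_mkseq // => /(_ kn).
  exact: le_ball (ltW ke) _.
exists l.
  apply: (closed_cvg _ cP _ _ zl); apply: nearW => n; exact: (hz n).1.1.
apply: agree_eq => n; apply: agree_sym.
have : nbhs l (f @^-1` cyl (f l) n).
  by apply: cf; apply/nbhs_cantor; exists n.
move=> /zl [m _ hm].
have := hm (maxn m n) (leq_maxl _ _) => fl.
have h : agree n x (f (z (maxn m n))) by apply: agree_le (hz _).2; exact: leq_maxr.
apply: agree_trans h _; exact: agree_sym.
Qed.

(** By [heavy_image] for the identity, a set [P] closed in the finer topology equals [heavy P] off a
    meager set, and [heavy P] is closed in the usual topology. Countably many complements of balls
    suffice as [P]. *)
Lemma finer_polish_meager (R : realType) (s : Topological (cantor R)) :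
  finer_polish R s -> exists2 N, meager N &
    forall (O : set (cantor R)) x, @open (Topological.Pack s) O -> O x -> ~ N x ->
      exists n, forall y, agree n x y -> ~ N y -> O y.
Proof.
move=> [[[D cD dD] [m]]]; set M : metricType R := Metric.Pack m.
move=> [oM complM] fin.
have cid : continuous (id : M -> cantor R).
  by apply/continuousP => A /fin; rewrite oM.
have D0 : D !=set0.
  have [|x [_ Dx]] := dD setT _ openT; first by exists (fun=> false).
  by exists x.
have [d hd] : exists d : nat -> M, forall z (e : R), (0 < e)%R -> exists a, ball (d a) e z.
  move: cD => /pfcard_geP[D00|[d]]; first by move: D0; rewrite D00 => -[].
  exists d => z e e0.
  have [||x [zx Dx]] := dD ((ball z e : set M)°).
  - exists z; exact: nbhsx_ballx.
  - by apply/oM; exact: open_interior.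
  have [a _ ad] := 'surj_d Dx.
  by exists a; apply: ball_sym; rewrite ad; exact: (interior_subset zx).
pose r b : R := (b.+1%:R^-1)%R.
have r0 b : (0 < r b)%R by rewrite invr_gt0 ltr0n.
pose P (ab : nat * nat) : set M := ~` (ball (d ab.1) (r ab.2))°.
have cP ab : closed (P ab) by apply: open_closedC; exact: open_interior.
have hN ab : exists N, meager N /\ heavy (P ab) `\` N `<=` P ab.
  have [N mN] := heavy_image hd complM cid (cP ab).
  by rewrite image_id; exists N.
have [N' hN'] := choice hN.
pose N := \bigcup_ab (N' ab `|` (P ab `\` heavy (P ab))).
exists N.
  by apply: meager_union => ab; apply: meagerU; [exact: (hN' ab).1|exact: meager_not_heavy].
move=> O x /oM oO Ox nNx.
have /nbhs_ballP [e e0 he] : nbhs (x : M) O by exact: open_nbhs_nbhs.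
(* The radius [r b] keeps the ball around [d a] inside [O]; a centre within [r b / 2] of [x] makes
   that ball a neighbourhood of [x]. *)
have [b be] : exists b, (r b < e / 2)%R by apply: inv_natr_lt; rewrite divr_gt0.
have rb0 : (0 < r b / 2)%R by rewrite divr_gt0.
have [a xa] := hd x _ rb0.
have yO y : ball (d a) (r b) y -> O y.
  move=> ay; apply: he; rewrite [e]splitr.
  apply: ball_triangle (le_ball (ltW be) ay); apply: ball_sym.
  apply: le_ball xa; rewrite (le_trans _ (ltW be)) // ler_pdivrMr // ler_peMr ?ler1n //.
  exact: ltW (r0 b).
have nPx : ~ P (a, b) x.
  suff hx : nbhs (x : M) (ball (d a) (r b)) by apply.
  apply: filterS (nbhsx_ballx (x : M) _ rb0) => y xy.
  by rewrite /= [r b]splitr; exact: ball_triangle xa xy.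
have /not_heavy [n hn] : ~ heavy (P (a, b)) x.
  move=> hx; apply: nPx; apply: (hN' (a, b)).2; split=> // Nx; apply: nNx.
  by exists (a, b) => //; left.
exists n => y xy nNy; apply: yO; apply: contrapT => nay.
apply: nNy; exists (a, b) => //; right; split; first by move=> /interior_subset.
by move=> /(_ n); rewrite -(cyl_eq xy).
Qed.

(** * Fusion *)

Definition splice (n : nat) (x y : nat -> bool) : nat -> bool :=
  fun k => if (k < n)%N then x k else y k.

Lemma splice_agree n x y : agree n x (splice n x y).
Proof. by move=> k kn; rewrite /splice kn. Qed.

(** One step of the fusion: a common tail after [L] drives both sequences away from [N], and the
    level is then chosen to carry exactly the words obtained. *)
Lemma nwdense_common_extension N c L x y : nwdense N -> exists l x' y',
  [/\ (L <= l)%N, agree L x x', agree L y y',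
      forall k, (L <= k < l)%N -> x' k = y' k
    & [/\ label l = c, agree l x' (nth false (level_code l).1.1),
      agree l y' (nth false (level_code l).1.2)
    & forall z, agree l x' z \/ agree l y' z -> ~ N z]].
Proof.
move=> hN.
have [x1 [L1 [xx1 LL1 hx1]]] := hN x L.
(* [y] takes over the tail of [x1] before being extended, and [x2] then takes over the tail of [y2];
   the first avoidance survives because [x1] and [x2] agree up to [L1]. *)
have [y2 [L2 [yy2 LL2 hy2]]] := hN (splice L y x1) L1.
pose x2 := splice L x y2.
have x1x2 : agree L1 x1 x2.
  move=> k kL; rewrite /x2 /splice; case: ifP => kL'; first by rewrite -xx1.
  by rewrite -yy2 // /splice kL'.
have [l ll cl] := level_code_unbounded (mkseq x2 L2) (mkseq y2 L2) c L2.
(* Both words are padded with [false] from [L2] on, so no difference appears between [L2] and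
   [l]. *)
exists l, (nth false (mkseq x2 L2)), (nth false (mkseq y2 L2)).
have ax : agree L2 x2 (nth false (mkseq x2 L2)) by move=> k kn; rewrite nth_mkseq.
have ay : agree L2 y2 (nth false (mkseq y2 L2)) by move=> k kn; rewrite nth_mkseq.
have LleL2 : (L <= L2)%N by exact: leq_trans LL2.
split.
- exact: leq_trans ll.
- by apply: agree_trans (agree_le LleL2 ax); exact: splice_agree.
- apply: agree_trans (agree_le LleL2 ay).
  by apply: agree_trans (agree_le LL1 yy2); exact: splice_agree.
- move=> k /andP[Lk kl]; have [kL2|kL2] := ltnP k L2.
    by rewrite -ax // -ay // /x2 /splice ltnNge Lk.
  by rewrite !nth_default ?size_mkseq.
- rewrite /label cl; split=> // z [] h.
    apply: hx1; apply: agree_trans x1x2 _.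
    by apply: (agree_le LL2); apply: agree_trans ax _; exact: agree_le h.
  by apply: hy2; apply: agree_trans ay _; exact: agree_le h.
Qed.

(** Stage [n] avoids the [n]-th nowhere dense set and ends at a level labelled [n] that carries the
    current words; there the left bit is [false] and the right bit is [a n]. *)
Lemma tree_graph_embedding (N : set (nat -> bool)) : meager N ->
  exists phi psi : (nat -> bool) -> (nat -> bool),
  [/\ forall a, tree_graph (phi a, psi a),
      forall a, ~ N (phi a) /\ ~ N (psi a),
      forall n a b, agree n a b -> agree n (phi a) (phi b) /\ agree n (psi a) (psi b),
      forall a k, (exists l, [/\ (0 < l)%N, phi a l <> psi a l & label l = k]) <-> a k
    & forall a l l', (0 < l)%N -> (0 < l')%N -> phi a l <> psi a l ->
        phi a l' <> psi a l' -> label l = label l' -> l = l'].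
Proof.
move=> [V [nV NV]].
have /choice[ext hext] : forall nst : nat * ((nat -> bool) * (nat -> bool) * nat),
    exists e : (nat -> bool) * (nat -> bool) * nat,
    [/\ (nst.2.2 <= e.2)%N, agree nst.2.2 nst.2.1.1 e.1.1,
      agree nst.2.2 nst.2.1.2 e.1.2,
      forall k, (nst.2.2 <= k < e.2)%N -> e.1.1 k = e.1.2 k
    & [/\ label e.2 = nst.1, agree e.2 e.1.1 (nth false (level_code e.2).1.1),
      agree e.2 e.1.2 (nth false (level_code e.2).1.2)
    & forall z, agree e.2 e.1.1 z \/ agree e.2 e.1.2 z -> ~ V nst.1 z]].
  move=> [n [[x y] L]].
  by have [l [x' [y' h]]] := nwdense_common_extension n L x y (nV n); exists (x', y', l).
pose st0 : (nat -> bool) * (nat -> bool) * nat := ((fun=> false), (fun k => k == 0%N), 1%N).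
pose st (a : nat -> bool) := fix st n := if n is m.+1 then
    let e := ext (m, st m) in
    (splice e.2 e.1.1 (fun=> false), splice e.2 e.1.2 (fun=> a m), e.2.+1)
  else st0.
pose e a n := ext (n, st a n).
have stS a n : st a n.+1 = (splice (e a n).2 (e a n).1.1 (fun=> false),
  splice (e a n).2 (e a n).1.2 (fun=> a n), (e a n).2.+1) by [].
have he a n := hext (n, st a n).
have Lle a n : (n < (st a n).2)%N.
  elim: n => [//|n IH]; rewrite stS /= ltnS; have [h _ _ _ _] := he a n.
  exact: leq_trans h.
have stle a n m : (n <= m)%N -> [/\ ((st a n).2 <= (st a m).2)%N,
    agree (st a n).2 (st a n).1.1 (st a m).1.1 & agree (st a n).2 (st a n).1.2 (st a m).1.2].
  move=> nm; rewrite -(subnKC nm); elim: (m - n)%N => [|k [IH1 IH2 IH3]].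
    by rewrite addn0.
  rewrite addnS stS /=; have [h1 h2 h3 _ _] := he a (n + k)%N.
  split; first by rewrite (leq_trans IH1) // ltnW.
    apply: agree_trans IH2 (agree_le IH1 _); apply: agree_trans h2 (agree_le h1 _).
    exact: splice_agree.
  apply: agree_trans IH3 (agree_le IH1 _); apply: agree_trans h3 (agree_le h1 _).
  exact: splice_agree.
(* At stage [k.+1] the words are longer than [k], so bit [k] is settled, and it depends only on [a]
   up to [k]. *)
pose phi a k := (st a k.+1).1.1 k; pose psi a k := (st a k.+1).1.2 k.
have stphi a n : agree (st a n).2 (st a n).1.1 (phi a) /\
    agree (st a n).2 (st a n).1.2 (psi a).
  have kL k : (k < (st a k.+1).2)%N by apply: leq_trans (Lle a k.+1).
  split=> k kn; rewrite /phi /psi; have [nk|kn'] := leqP n k.+1.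
  - by have [_ -> //] := stle a _ _ nk.
  - by have [_ <- //] := stle a _ _ (ltnW kn').
  - by have [_ _ -> //] := stle a _ _ nk.
  - by have [_ _ <- //] := stle a _ _ (ltnW kn').
have ephi a n : [/\ agree (e a n).2 (e a n).1.1 (phi a), agree (e a n).2 (e a n).1.2 (psi a),
    phi a (e a n).2 = false & psi a (e a n).2 = a n].
  have [h1 h2] := stphi a n.+1; move: h1 h2; rewrite stS /= => h1 h2; split.
  - by move=> k kn; rewrite -(h1 k (ltnW kn)); exact: splice_agree.
  - by move=> k kn; rewrite -(h2 k (ltnW kn)); exact: splice_agree.
  - by rewrite -(h1 _ (ltnSn _)) /splice ltnn.
  - by rewrite -(h2 _ (ltnSn _)) /splice ltnn.
have e_gt0 a n : (0 < (e a n).2)%N.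
  by have [h _ _ _ _] := he a n; apply: leq_trans h; exact: leq_trans (Lle a n).
(* After position 0, differences occur only at the levels chosen by the construction, and there only
   if the bit of [a] is true. *)
have diff a k : (0 < k)%N -> phi a k <> psi a k -> exists2 m, k = (e a m).2 & a m.
  move=> k0 d.
  suff : forall n, (k < (st a n).2)%N -> exists2 m, k = (e a m).2 & a m.
    by move=> /(_ k); apply; exact: Lle.
  elim => [|n IH]; first by rewrite /=; lia.
  rewrite stS /= ltnS leq_eqVlt => /orP[/eqP ke|ke].
    exists n => //; move: d; rewrite ke; have [_ _ -> ->] := ephi a n.
    by case: (a n).
  have [kL|Lk] := ltnP k (st a n).2; first exact: IH.
  exfalso; apply: d; have [p1 p2 _ _] := ephi a n; have [_ _ _ h _] := he a n.
  by rewrite -p1 // -p2 //; apply: h; rewrite /= Lk.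
have labele a n : label (e a n).2 = n by have [_ _ _ _ []] := he a n.
exists phi, psi; split.
- move=> a; have [h1 h2] := stphi a 0%N.
  split; [by rewrite /= -h1|by rewrite /= -h2|move=> [|l] /=].
    (* At level 0 the words are empty, so the initial bits [false] and [true] form the special
       edge. *)
    by right; split; rewrite -?h1 -?h2.
  case: (pselect (phi a l.+1 = psi a l.+1)) => [|d]; first by left.
  have [m -> am] := diff _ _ (ltn0Sn l) d; right.
  have [p1 p2 p3 p4] := ephi a m; have [_ _ _ _ [_ q1 q2 _]] := he a m.
  split=> //; last by rewrite p4.
    by apply: agree_trans q1; exact: agree_sym.
  by apply: agree_trans q2; exact: agree_sym.
- move=> a; have h m z : agree (e a m).2 (phi a) z \/ agree (e a m).2 (psi a) z -> ~ V m z.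
    have [p1 p2 _ _] := ephi a m; have [_ _ _ _ [_ _ _ q]] := he a m.
    move=> h; apply: q; case: h => h; [left|right]; [exact: agree_trans h|exact: agree_trans h].
  by split=> /NV [m _]; apply: h; [left|right].
- move=> n a b ab.
  have stab m : (m <= n)%N -> st a m = st b m.
    elim: m => // m IH mn; have mn' := ltnW mn.
    by rewrite !stS /e IH // ab.
  by split=> k kn; rewrite /phi /psi stab.
- move=> a k; split=> [[l [l0 d <-]]|ak].
    by have [m -> am] := diff a l l0 d; rewrite labele.
  exists (e a k).2; split=> //; have [_ _ -> ->] := ephi a k.
  by rewrite ak.
- move=> a l l' l0 l0' /(diff _ _ l0) [m -> _] /(diff _ _ l0') [m' -> _].
  by rewrite !labele => ->.
Qed.

(** * Potential classes and common reducts *)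

Lemma pot_refl (R : realType) (G : set_class) (X : topologicalType)
  (B : set (X * X)) : polish R X -> borel B -> G (X * X)%type B -> pot R G B.
Proof.
by case: X B => X c B pX bB GB; split=> //; exists c, c; split.
Qed.

Lemma borel_setC (T : topologicalType) (A : set T) : borel A -> borel (~` A).
Proof.
move=> bA; have [_ hC _] := smallest_sigma_algebra [set: T] (@open T).
by have := hC _ bA; rewrite setTD.
Qed.

Lemma borel_setU (T : topologicalType) (A B : set T) :
  borel A -> borel B -> borel (A `|` B).
Proof.
move=> bA bB; have [_ _ hU] := smallest_sigma_algebra [set: T] (@open T).
rewrite -bigcup2E; apply: hU => -[|[|n]] //=.
by have [h0 _ _] := smallest_sigma_algebra [set: T] (@open T).
Qed.

Lemma borel_setI (T : topologicalType) (A B : set T) :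
  borel A -> borel B -> borel (A `&` B).
Proof.
move=> bA bB; rewrite -[A `&` B]setCK setCI.
by apply: borel_setC; apply: borel_setU; apply: borel_setC.
Qed.

Lemma borel_closed (T : topologicalType) (A : set T) : closed A -> borel A.
Proof.
by move=> cA; rewrite -[A]setCK; apply: borel_setC; apply: sub_gen_smallest; exact: closed_openC.
Qed.

Lemma borel_preimage (S T : topologicalType) (f : S -> T) (A : set T) :
  continuous f -> borel A -> borel (f @^-1` A).
Proof.
move=> cf; apply: (smallest_sub (C := sigma_algebra setT) (X := [set B | borel (f @^-1` B)])).
  have [h0 hC hU] := smallest_sigma_algebra [set: S] (@open S).
  split=> /=; first by rewrite preimage_set0.
  - by move=> B bB; rewrite setTD -preimage_setC; exact: borel_setC.
  - by move=> B bB; rewrite preimage_bigcup; exact: hU.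
by move=> O oO; apply: sub_gen_smallest; exact: open_comp.
Qed.

Lemma closed_preimage (S T : topologicalType) (f : S -> T) (A : set T) :
  continuous f -> closed A -> closed (f @^-1` A).
Proof. by move=> /continuous_closedP; apply. Qed.

Lemma continuous_swap (X : topologicalType) : continuous (fun p : X * X => (p.2, p.1)).
Proof. by move=> p; apply: cvg_pair; [exact: cvg_snd|exact: cvg_fst]. Qed.

Section cantor_square.
Context (R : realType).
Local Notation E := (cantor R).

Lemma perfect_square : perfect (E * E)%type.
Proof. exact: (@perfect_pseudometric R). Qed.

Lemma perfect_square2 : perfect ((E * E) * (E * E))%type.
Proof. exact: (@perfect_pseudometric R). Qed.

Lemma open_square (A : set (E * E)) :
  (forall p, A p -> exists n, forall q, agree n p.1 q.1 -> agree n p.2 q.2 -> A q) ->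
  open A.
Proof.
move=> h; rewrite openE => -[x y] /h [n hn].
exists (cyl x n, cyl y n); first by split; apply/nbhs_cantor; exists n.
by move=> [u v] [xu yv]; exact: hn.
Qed.

Lemma closed_square (A : set (E * E)) :
  (forall p, ~ A p -> exists n, forall q, agree n p.1 q.1 -> agree n p.2 q.2 -> ~ A q) ->
  closed A.
Proof. by move=> h; rewrite -openC; exact: open_square. Qed.

Lemma closed_tree_graph : closed (tree_graph : set (E * E)).
Proof.
apply: closed_square => -[x y] np.
case: (pselect (forall l, step l x y)) => [hs|/existsNP[l nl]]; last first.
  exists l.+1 => -[u v] /= xu yv [_ _ /= /(_ l) h]; apply: nl; case: h => [e|[h1 h2 h3 h4]].
    by left; rewrite xu // yv.
  right; split; rewrite ?xu ?yv //.
    by apply: agree_trans h1; exact: agree_le xu.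
  by apply: agree_trans h2; exact: agree_le yv.
exists 1%N => -[u v] /= xu yv [/= h1 h2 _]; apply: np; split=> //=.
  by rewrite xu.
by rewrite yv.
Qed.

(** Position 0 is left out, as the two ends of an edge of [tree_graph] always differ there. *)
Definition differ (p : E * E) (l : nat) : Prop := (0 < l)%N /\ p.1 l <> p.2 l.

Lemma differ_agree p q l : agree l.+1 p.1 q.1 -> agree l.+1 p.2 q.2 ->
  differ p l -> differ q l.
Proof. by move=> h1 h2 [l0 d]; split=> //; rewrite -h1 // -h2. Qed.

Definition diff_labels (p : E * E) : nat -> bool :=
  fun k => `[< exists2 l, differ p l & label l = k >].

Lemma Sigma0_hard_labels xi : Sigma0 xi [set p | hard xi (diff_labels p)].
Proof.
apply: (Sigma0_hard xi (D := fun k => [set p | exists2 l, differ p l & label l = k])).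
  exact: perfect_square.
move=> k; apply: open_square => p [l d lk]; exists l.+1 => q h1 h2.
by exists l => //; exact: differ_agree d.
Qed.

(** The fusion avoids the meager sets of both finer topologies, so its coordinates are continuous
    into them and membership in the class pulls back. Injectivity of the labels on differences
    serves the locally countable case. *)
Lemma pot_pullback (G : borel_class) (B : set (E * E)) : pot R (class_sets G) B ->
  exists phi psi : E -> E,
  [/\ forall a, tree_graph (phi a, psi a), forall a, diff_labels (phi a, psi a) = a,
      forall a l l', differ (phi a, psi a) l -> differ (phi a, psi a) l' ->
        label l = label l' -> l = l'
    & class_sets G [set a : E | B (phi a, psi a)]].
Proof.
move=> [_ [s [t [/finer_polish_meager [M mM hM] /finer_polish_meager [N mN hN] GB]]]].
have [phi [psi [h1 h2 h3 h4 h5]]] := tree_graph_embedding (meagerU mM mN).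
have avoid a : [/\ ~ M (phi a), ~ N (phi a), ~ M (psi a) & ~ N (psi a)].
  by have [n1 n2] := h2 a; split=> ?; [apply: n1; left|apply: n1; right
    |apply: n2; left|apply: n2; right].
exists phi, psi; split=> //.
- move=> a; apply/funext => k; apply/asboolP/idP => [[l [l0 d] lk]|/h4 [l [l0 d lk]]].
    by apply/h4; exists l.
  by exists l.
- by move=> a l l' [l0 d] [l0' d']; exact: h5 l0 l0' d d'.
pose f a : Topological.Pack s * Topological.Pack t := (phi a, psi a).
have cf : continuous (f : E -> (Topological.Pack s * Topological.Pack t)%type).
  have c1 : continuous (phi : E -> Topological.Pack s).
    apply/continuousP => O oO; apply/open_cantor => a Oa.
    have [n hn] := hM O (phi a) oO Oa (let: And4 h _ _ _ := avoid a in h).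
    by exists n => b ab; apply: hn; [exact: (h3 _ _ _ ab).1|have [] := avoid b].
  have c2 : continuous (psi : E -> Topological.Pack t).
    apply/continuousP => O oO; apply/open_cantor => a Oa.
    have [n hn] := hN O (psi a) oO Oa (let: And4 _ _ _ h := avoid a in h).
    by exists n => b ab; apply: hn; [exact: (h3 _ _ _ ab).2|have [] := avoid b].
  by move=> a; exact: (cvg_pair (c1 a) (c2 a)).
exact: (class_sets_preimage cf GB).
Qed.

Definition flip_outside (F S : set (E * E)) : set (E * E) := S `|` rel_inv (F `\` S).

Section subgraph.
Variables F S : set (E * E).
Hypotheses (FT : F `<=` tree_graph) (SF : S `<=` F).

Lemma sym_flip_outside : sym_closure (flip_outside F S) `<=` sym_closure tree_graph.
Proof.
move=> [x y] [] [] /= => [h|[h _]|h|[h _]].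
- by left; apply/FT/SF.
- by right; apply: FT.
- by right; apply: FT; apply: SF.
- by left; apply: FT.
Qed.

Lemma Acyclic_flip_outside : Acyclic_oriented_graph (flip_outside F S).
Proof.
split; first exact: acyclic_subset sym_flip_outside acyclic_tree_graph.
have side x y : F (x, y) -> x 0%N = false /\ y 0%N = true by move=> /FT [].
split=> [x|[x y]].
  by case=> [/SF|[]] /side [/= ->].
case=> [] [] /=.
- move=> Sxy [/SF|[_ nS]]; last by [].
  by move=> /side [/= y0 _]; have [_] := side _ _ (SF Sxy); rewrite y0.
- move=> [Fyx nSyx] [//|[Fxy _]].
  by have [/= e _] := side _ _ Fyx; have [_ /=] := side _ _ Fxy; rewrite e.
Qed.

Lemma Acyclic_subgraph : Acyclic_oriented_graph S.
Proof.
have SB : S `<=` flip_outside F S by move=> p; left.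
have [ac [irr ori]] := Acyclic_flip_outside; split.
  by apply: acyclic_subset ac => p [/SB|/SB]; [left|right].
by split=> [x /SB /irr //|p [/SB h1 /SB h2]]; exact: ori.
Qed.

(** A reversed edge starts on the side with first bit [true], so it is never in [tree_graph]. Hence
    a test along [tree_graph] sees only [S]. *)
Lemma flip_outsideE p : tree_graph p -> flip_outside F S p <-> S p.
Proof.
move=> [_ h _]; split=> [[//|[/FT [/=]]]|]; last by left.
by rewrite h.
Qed.

(* The reduction to S separates sources from sinks by a clopen set; then the
   reduction to the flipped graph can no longer distinguish S from F \ S. *)
Lemma common_reduct (X : topologicalType) (A : set (X * X)) G : closed F ->
  G <> SigmaClass ord_one -> reduces A S -> reduces A (flip_outside F S) ->
  class_sets G A.
Proof.
move=> cF G1 [f [_ cf fA]] [g [_ cg gA]].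
pose h (p : X * X) : (E * E) * (E * E) := ((f p.1, f p.2), (g p.1, g p.2)).
pose U : set (E * E) := [set p | p.1 0%N = false /\ p.2 0%N = true].
pose L : set ((E * E) * (E * E)) :=
  (fst @^-1` U) `&` ((snd @^-1` F) `|` (snd @^-1` rel_inv F)).
have ch : continuous h.
  have cfst : continuous (fst : X * X -> X) by move=> p; exact: cvg_fst.
  have csnd : continuous (snd : X * X -> X) by move=> p; exact: cvg_snd.
  have c1 (k : X -> E) : continuous k -> continuous (fun p : X * X => (k p.1, k p.2)).
    move=> ck p; have h1 := continuous_comp (cfst p) (ck _).
    by have h2 := continuous_comp (csnd p) (ck _); exact: (cvg_pair h1 h2).
  by move=> p; exact: (cvg_pair (c1 f cf p) (c1 g cg p)).
have cU : closed U.
  apply: closed_square => -[x y] nU; exists 1%N => -[u v] xu yv [/= hu hv].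
  by apply: nU; split; [rewrite -hu; exact: xu|rewrite -hv; exact: yv].
have cL : closed L.
  have c1 : continuous (fst : (E * E) * (E * E) -> E * E) by move=> p; exact: cvg_fst.
  have c2 : continuous (snd : (E * E) * (E * E) -> E * E) by move=> p; exact: cvg_snd.
  apply: closedI; first exact: closed_preimage c1 cU.
  apply: closedU; first exact: closed_preimage c2 cF.
  exact: closed_preimage c2 (closed_preimage (@continuous_swap E) cF).
rewrite (_ : A = h @^-1` L); last first.
  have sideA x y : A (x, y) -> U (f x, f y) by move=> /fA /SF /FT [].
  apply/seteqP; split=> -[x y].
    move=> Axy; split; first exact: sideA.
    by have /gA [/SF|[]] := Axy; [left|right].
  move=> [[/= fx fy]] Fg.
  (* The pair of [g]-images, in one of its two orders, is an edge of the flipped graph; the first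
     bits under [f] exclude the order from [y] to [x]. *)
  have nA : ~ A (y, x) by move=> /sideA [/=]; rewrite fy.
  case: Fg => /= Fg.
    apply/gA; case: (pselect (S (g x, g y))) => Sg; first by left.
    by exfalso; apply: nA; apply/gA; right.
  apply/gA; case: (pselect (S (g y, g x))) => Sg; last by right.
  by exfalso; apply: nA; apply/gA; left.
apply: (class_sets_preimage ch); apply: class_sets_closed => //.
exact: perfect_square2.
Qed.

Lemma no_minimum (C : rel_class) G : closed F -> G <> SigmaClass ord_one ->
  (forall (X : topologicalType) (A : set (X * X)), C X A ->
     [/\ polish R X, borel A & ~ pot R (class_sets G) A]) ->
  C E S -> C E (flip_outside F S) -> ~ has_minimum C.
Proof.
move=> cF G1 hC CS CB [X [A [CA minA]]].
have [pX bA npA] := hC _ _ CA; apply: npA; apply: pot_refl => //.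
by apply: common_reduct; [| |exact: minA|exact: minA].
Qed.

End subgraph.
End cantor_square.

(** * The examples *)

Lemma class_sets_setI_closed (T : topologicalType) G (A F : set T) : perfect T ->
  ord_lt ord_one (class_rank G) -> closed F -> class_sets G A ->
  class_sets G (A `&` F).
Proof.
move=> pT; case: G => xi /= rk cF hA; first exact: Sigma0_setI_closed.
rewrite /Pi0 setCI; apply: Sigma0_setU => //.
by apply: Sigma0_open_le => //; exact: closed_openC.
Qed.

Lemma class_sets_setU_open (T : topologicalType) G (A O : set T) : perfect T ->
  ord_lt ord_one (class_rank G) -> open O -> class_sets G A ->
  class_sets G (A `|` O).
Proof.
move=> pT; case: G => xi /= rk oO hA.
  by apply: Sigma0_setU => //; exact: Sigma0_open_le.
by rewrite /Pi0 setCU; apply: Sigma0_setI_closed => //; exact: open_closedC.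
Qed.

(** Chosen so as to be outside [G] with a complement of class [G]. *)
Definition hard_set (G : borel_class) : set (nat -> bool) :=
  match G with
  | SigmaClass xi => ~` [set a | hard xi a]
  | PiClass xi => [set a | hard xi a]
  end.

Section examples.
Context (R : realType) (G : borel_class).
Local Notation E := (cantor R).
Local Notation graph := (tree_graph : set (E * E)).

Lemma hard_set_not_class : ~ class_sets G (hard_set G : set E).
Proof. by case: G => xi /= h; apply: (@hard_not_Pi0 R xi). Qed.

Definition hard_code : set (E * E) := [set p | hard_set G (diff_labels p)].

Lemma class_sets_hard_codeC : class_sets G (~` hard_code).
Proof.
rewrite /hard_code; case: G => xi /=.
  rewrite (_ : ~` _ = [set p | hard xi (diff_labels p)]); first exact: Sigma0_hard_labels.
  by rewrite -[RHS]setCK.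
by rewrite /Pi0 setCK; exact: Sigma0_hard_labels.
Qed.

Lemma borel_hard_code : borel hard_code.
Proof.
have := class_sets_hard_codeC; case: G => xi /= /Sigma0_borel.
  by move=> /borel_setC; rewrite setCK.
by rewrite setCK.
Qed.

Definition hard_graph : set (E * E) := graph `&` hard_code.

Lemma hard_graph_sub : hard_graph `<=` graph.
Proof. by move=> p []. Qed.

(** The fusion stays in [tree_graph] and inverts the decoding, so [B] pulls back to [hard_set G].
    Agreement along [tree_graph] is enough, which covers the graph and its flip at once. *)
Lemma not_pot_hard_graph (B : set (E * E)) :
  (forall p, graph p -> B p <-> hard_graph p) -> ~ pot R (class_sets G) B.
Proof.
move=> BS /pot_pullback [phi [psi [gr dec _ h]]]; apply: hard_set_not_class.
rewrite (_ : hard_set G = [set a : E | B (phi a, psi a)]) //.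
apply/seteqP; split=> a /=.
  by move=> ha; apply/(BS _ (gr a)); split=> //; rewrite /hard_code /= dec.
by move=> /(BS _ (gr a)) [_]; rewrite /hard_code /= dec.
Qed.

Lemma borel_hard_graph : borel hard_graph.
Proof.
apply: borel_setI; last exact: borel_hard_code.
exact: borel_closed (@closed_tree_graph R).
Qed.

Lemma borel_flip (F S : set (E * E)) : closed F -> borel S -> borel (flip_outside F S).
Proof.
move=> cF bS; apply: borel_setU => //.
apply: (@borel_preimage _ _ (fun p : E * E => (p.2, p.1))); first exact: continuous_swap.
by rewrite setDE; apply: borel_setI; [exact: borel_closed|exact: borel_setC].
Qed.

Lemma no_minimum_Acyclic : G <> SigmaClass ord_one ->
  ~ has_minimum (nonpot_Acyclic_graphs R (class_sets G)).
Proof.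
move=> G1; apply: (@no_minimum R graph hard_graph) => //.
- exact: hard_graph_sub.
- exact: (@closed_tree_graph R).
- exact: G1.
- by move=> X A [].
- split; [exact: polish_cantor|exact: borel_hard_graph| |exact: not_pot_hard_graph].
  exact: Acyclic_subgraph hard_graph_sub.
- split; first exact: polish_cantor.
  + by apply: borel_flip; [exact: (@closed_tree_graph R)|exact: borel_hard_graph].
  + exact: Acyclic_flip_outside hard_graph_sub.
  + by apply: not_pot_hard_graph => p; exact: flip_outsideE.
Qed.

Lemma dual_class_hard_graph : ord_lt ord_one (class_rank G) ->
  dual_class (class_sets G) hard_graph.
Proof.
move=> G2; rewrite /dual_class /hard_graph /= setCI setUC.
apply: class_sets_setU_open => //; first exact: (@perfect_square R).
  exact: closed_openC (@closed_tree_graph R).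
exact: class_sets_hard_codeC.
Qed.

Lemma clopen_right : clopen [set p : E * E | p.1 0%N = true].
Proof.
split; [apply: open_square|apply: closed_square] => p hp; exists 1%N => q pq _;
  by have := pq 0%N isT; move: hp => /= hp e; rewrite -e.
Qed.

Lemma pot_hard_graph : ord_lt ord_one (class_rank G) ->
  pot R (oplus_class (class_sets G) (dual_class (class_sets G))) hard_graph.
Proof.
move=> G2; apply: pot_refl; [exact: polish_cantor|exact: borel_hard_graph|].
(* The graph itself is in the dual class, so the clopen set is taken empty. *)
exists set0, hard_graph, set0; split.
- apply: class_sets_closed closed0; first exact: (@perfect_square R).
  by move=> e; move: G2; rewrite e.
- exact: dual_class_hard_graph.
- by split; [exact: open0|exact: closed0].
- by rewrite setD0 set0I set0U.
Qed.

Lemma pot_flip_hard_graph : ord_lt ord_one (class_rank G) ->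
  pot R (oplus_class (class_sets G) (dual_class (class_sets G)))
    (flip_outside graph hard_graph).
Proof.
move=> G2; apply: pot_refl; first exact: polish_cantor.
  by apply: borel_flip; [exact: (@closed_tree_graph R)|exact: borel_hard_graph].
(* The first bit of the source separates the reversed edges, a set of class [G], from the kept ones,
   a set of the dual class. *)
exists (rel_inv (graph `\` hard_graph)), hard_graph, [set p : E * E | p.1 0%N = true].
split.
- apply: (@class_sets_preimage _ _ (fun p : E * E => (p.2, p.1))).
    exact: continuous_swap.
  rewrite /hard_graph setDIr setDv set0U setDE setIC.
  apply: class_sets_setI_closed => //; first exact: (@perfect_square R).
    exact: (@closed_tree_graph R).
  exact: class_sets_hard_codeC.
- exact: dual_class_hard_graph.
- exact: clopen_right.
- rewrite /flip_outside setUC; congr (_ `|` _).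
    by apply/seteqP; split=> p; [move=> h; split=> //; case: h => -[]|case].
  apply/seteqP; split=> p; last by case.
  by move=> h; split=> //; case: h => -[/= -> _ _ _].
Qed.

Lemma no_minimum_subgraphs : ord_lt ord_one (class_rank G) ->
  ~ has_minimum (nonpot_subgraphs R (class_sets G)
      (oplus_class (class_sets G) (dual_class (class_sets G)))).
Proof.
move=> G2; apply: (@no_minimum R graph hard_graph _ _ _ G) => //.
- exact: hard_graph_sub.
- exact: (@closed_tree_graph R).
- by move=> e; move: G2; rewrite e.
- by move=> X A [].
- split; [exact: polish_cantor|exact: borel_hard_graph|exact: not_pot_hard_graph|].
  exists hard_graph; split; [exact: pot_hard_graph| |by []].
  exact: Acyclic_subgraph hard_graph_sub.
- split; first exact: polish_cantor.
  + by apply: borel_flip; [exact: (@closed_tree_graph R)|exact: borel_hard_graph].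
  + by apply: not_pot_hard_graph => p; exact: flip_outsideE.
  + exists (flip_outside graph hard_graph); split; [exact: pot_flip_hard_graph| |by []].
    exact: Acyclic_flip_outside hard_graph_sub.
Qed.

End examples.

(** * The locally countable example *)

Section locally_countable_example.
Context (R : realType).
Local Notation E := (cantor R).
Local Notation graph := (tree_graph : set (E * E)).

Definition thin_graph : set (E * E) := graph `&`
  [set p | forall l l', differ p l -> differ p l' -> l = l'].

(** This plays the part of [S] inside [thin_graph]; it decodes to sequences with exactly one true
    bit. *)
Definition strict_graph : set (E * E) := thin_graph `&` [set p | exists l, differ p l].

Lemma thin_graph_sub : thin_graph `<=` graph. Proof. by move=> p []. Qed.

Lemma strict_graph_sub : strict_graph `<=` thin_graph. Proof. by move=> p []. Qed.

Lemma closed_thin_graph : closed thin_graph.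
Proof.
apply: closedI; first exact: (@closed_tree_graph R).
apply: closed_square => p /= /existsNP[l /existsNP[l' /not_implyP[d /not_implyP[d' ne]]]].
exists (maxn l l').+1 => q h1 h2 h; apply: ne; apply: h.
  by apply: differ_agree d; [apply: agree_le h1|apply: agree_le h2]; rewrite ltnS leq_maxl.
by apply: differ_agree d'; [apply: agree_le h1|apply: agree_le h2]; rewrite ltnS leq_maxr.
Qed.

Lemma open_differ : open [set p : E * E | exists l, differ p l].
Proof.
apply: open_square => p [l d]; exists l.+1 => q h1 h2.
by exists l; exact: differ_agree d.
Qed.

Lemma borel_strict_graph : borel strict_graph.
Proof.
apply: borel_setI; first exact: borel_closed closed_thin_graph.
by apply: sub_gen_smallest; exact: open_differ.
Qed.

(** Sequences with a single true bit, placed further and further, converge to the zero sequence. *)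
Lemma not_closed_singletons :
  ~ closed [set a : E | (exists k, a k) /\ forall k k', a k -> a k' -> k = k'].
Proof.
move=> /closed_openC /open_cantor /(_ (fun=> false)) [|n hn].
  by move=> [[]].
have /hn : agree n (fun=> false) (fun k => k == n).
  by move=> k kn; rewrite ltn_eqF.
by apply; split; [exists n|move=> k k' /eqP -> /eqP ->].
Qed.

(** Along the fusion, labels are injective on differences, so having exactly one difference means
    that [a] has exactly one true bit. The pullback is thus a set that is not closed. *)
Lemma not_pot_strict_graph (B : set (E * E)) :
  (forall p, thin_graph p -> B p <-> strict_graph p) -> B `&` graph `<=` thin_graph ->
  ~ pot R (class_sets (PiClass ord_one)) B.
Proof.
move=> BS BT /pot_pullback [phi [psi [gr dec inj h]]]; apply: not_closed_singletons.
rewrite -openC; move: h => /Sigma0_inv; congr open; congr (~` _).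
have decP (a : E) k : a k <-> exists2 l, differ (phi a, psi a) l & label l = k.
  by rewrite -{1}(dec a); split=> [/asboolP|h]; last exact/asboolP.
apply/seteqP; split=> a /=.
  move=> Ba; have [_ thin] := BT _ (conj Ba (gr a)).
  have /BS [/(_ Ba) [_ [l d]] _] := BT _ (conj Ba (gr a)).
  split; first by exists (label l); apply/decP; exists l.
  by move=> k k' /decP [l1 d1 <-] /decP [l2 d2 <-]; rewrite (thin _ _ d1 d2).
move=> [[k /decP [l d _]] uniq].
have th : thin_graph (phi a, psi a).
  split=> //= l1 l2 d1 d2; apply: (inj a) => //.
  by apply: uniq; apply/decP; [exists l1|exists l2].
by apply/(BS _ th); split=> //; exists l.
Qed.

Lemma D2_strict_graph : D2_open strict_graph.
Proof.
exists [set p | exists l, differ p l], (~` thin_graph); split.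
- exact: open_differ.
- exact: closed_openC closed_thin_graph.
- by rewrite setDE setCK setIC.
Qed.

Lemma D2_flip_strict_graph : D2_open (flip_outside thin_graph strict_graph).
Proof.
pose Z := thin_graph `\` strict_graph.
have cZ : closed Z.
  rewrite /Z /strict_graph setDIr setDv set0U setDE.
  by apply: closedI; [exact: closed_thin_graph|exact: open_closedC open_differ].
have cZ' : closed (rel_inv Z).
  exact: (@closed_preimage _ _ (fun p : E * E => (p.2, p.1)) Z (@continuous_swap E)).
(* The subtracted open set leaves two closed pieces. The source bit is [false] on [thin_graph],
   where a difference is then required, and [true] on the reversed piece, which is kept whole. *)
exists ([set p | exists l, differ p l] `|` [set p : E * E | p.1 0%N = true]),
  (~` (thin_graph `|` rel_inv Z)); split.
- by apply: openU; [exact: open_differ|have [] := clopen_right R].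
- by apply: closed_openC; apply: closedU => //; exact: closed_thin_graph.
rewrite setDE setCK; apply/seteqP; split=> p.
  case=> [Sp|Zp]; first by split; [left; case: Sp|left; case: Sp].
  by split; [right; case: Zp => -[[/= _ -> _] _] _|right].
case=> O [Tp|Zp]; last by right.
left; split=> //; case: O => // /= p0.
by case: Tp => -[/=]; rewrite p0.
Qed.

(** Countably many involutions, flipping bit 0 and at most one further bit, whose graphs cover
    [thin_graph] and its inverse; this bounds the sections. *)
Definition flip_bits (o : option nat) (x : E) : E :=
  fun k => x k (+) ((k == 0%N) || (Some k == o)).

Lemma thin_graph_flip_bits x y : thin_graph (x, y) -> exists o, y = flip_bits o x.
Proof.
move=> [[/= x0 y0 _] thin].
have eqD k o : (forall l, differ (x, y) l -> Some l = o) -> (0 < k)%N -> Some k <> o ->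
    y k = x k.
  move=> h k0 ko; apply: contrapT => d; apply: ko; apply: h; split=> //.
  by move=> e; apply: d.
case: (pselect (exists l, differ (x, y) l)) => [[l d]|nd].
  exists (Some l); apply/funext => -[|k]; rewrite /flip_bits ?x0 ?y0 //=.
  case: (eqVneq k.+1 l) => [->|kl].
    by rewrite eqxx; case: d => _ /=; case: (x l); case: (y l).
  rewrite (@eqD k.+1 (Some l)) //; last by move=> [/eqP]; rewrite (negbTE kl).
    by case: eqP => [[/eqP]|]; rewrite ?(negbTE kl) //= addbF.
  by move=> l' d'; rewrite (thin _ _ d' d).
exists None; apply/funext => -[|k]; rewrite /flip_bits ?x0 ?y0 //= addbF.
by apply: (@eqD _ None) => // l d; exfalso; apply: nd; exists l.
Qed.

Lemma flip_bitsK o : involutive (flip_bits o).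
Proof. by move=> x; apply/funext => k; rewrite /flip_bits -addbA addbb addbF. Qed.

Lemma locally_countable_thin (B : set (E * E)) :
  B `<=` sym_closure thin_graph -> locally_countable B.
Proof.
move=> BT.
have nb x y : B (x, y) -> exists o, y = flip_bits o x.
  move=> /BT [] /thin_graph_flip_bits [i /= ->]; exists i; first by [].
  by rewrite flip_bitsK.
have cr x : countable (range (fun o => flip_bits o x)).
  by apply: (card_le_trans (card_image_le _ _)); exact: countableP.
split=> x; apply: sub_countable (cr x); apply: subset_card_le => y.
  by rewrite /xsection /= inE => /nb [i ->]; exists i.
by rewrite /ysection /= inE => /nb [i ->]; exists i => //; rewrite flip_bitsK.
Qed.

Lemma no_minimum_locally_countable :
  ~ has_minimum (fun (X : topologicalType) (B : set (X * X)) =>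
      nonpot_subgraphs R (class_sets (PiClass ord_one)) D2_open B /\
      locally_countable B).
Proof.
pose flip := flip_outside thin_graph strict_graph.
have flipT : flip `&` graph `<=` thin_graph.
  by move=> p [Bp gp]; apply: strict_graph_sub; apply/(flip_outsideE _ thin_graph_sub gp).
have bflip : borel flip by apply: borel_flip; [exact: closed_thin_graph|exact: borel_strict_graph].
apply: (@no_minimum R thin_graph strict_graph _ _ _ (PiClass ord_one)) => //.
- exact: thin_graph_sub.
- exact: strict_graph_sub.
- exact: closed_thin_graph.
- by move=> X A [[]].
- split; last by apply: locally_countable_thin => p [Tp _]; left.
  split; [exact: polish_cantor|exact: borel_strict_graph| |].
    by apply: not_pot_strict_graph => // p [/strict_graph_sub].
  exists strict_graph; split; last by [].
    by apply: pot_refl; [exact: polish_cantor|exact: borel_strict_graph|exact: D2_strict_graph].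
  exact: Acyclic_subgraph thin_graph_sub strict_graph_sub.
- split; last first.
    by apply: locally_countable_thin => p [[Tp _]|[Tp _]]; [left|right].
  split; [exact: polish_cantor|exact: bflip| |].
    apply: not_pot_strict_graph flipT => p Tp.
    exact: (flip_outsideE _ thin_graph_sub (thin_graph_sub Tp)).
  exists flip; split; last by [].
    by apply: pot_refl; [exact: polish_cantor|exact: bflip|exact: D2_flip_strict_graph].
  exact: Acyclic_flip_outside thin_graph_sub strict_graph_sub.
Qed.

End locally_countable_example.

Theorem theorem1p11 (R : realType) (Gamma : borel_class) :
  [/\ Gamma <> SigmaClass ord_one ->
        ~ has_minimum (nonpot_Acyclic_graphs R (class_sets Gamma)),
      ord_lt ord_one (class_rank Gamma) ->
        ~ has_minimum (nonpot_subgraphs R (class_sets Gamma)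
            (oplus_class (class_sets Gamma) (dual_class (class_sets Gamma))))
    & Gamma = PiClass ord_one ->
        ~ has_minimum (fun (X : topologicalType) (B : set (X * X)) =>
            nonpot_subgraphs R (class_sets Gamma) D2_open B /\
            locally_countable B)].
Proof.
split; first exact: no_minimum_Acyclic.
  exact: no_minimum_subgraphs.
by move=> ->; exact: no_minimum_locally_countable.
Qed.
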